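(* Let $\mathcal{C}:\ell^{2}\rightarrow\ell^{2}$ be the Cesaro operator, $$\mathcal{C}\big((x_{n})_{n=0}^{+\infty}\big)=\Big(\frac{1}{n+1}\sum_{k=0}^{n}x_{k}\Big)_{n=0}^{+\infty}.$$ Then $\mathcal{C}$ is essentially normal, i.e. the self commutator $[\mathcal{C}^{\ast},\mathcal{C}]:=\mathcal{C}^{\ast}\mathcal{C}-\mathcal{C}\mathcal{C}^{\ast}$ is a compact operator on $\ell^{2}$.
   Context: $\ell^{2}=\{(x_{n})_{n=0}^{+\infty}: x_{n}\in\mathbb{C},\ \sum_{n=0}^{+\infty}|x_{n}|^{2}<+\infty\}$ is the Hilbert space of square summable complex sequences with inner product $\langle (x_n),(y_n)\rangle=\sum_{n=0}^{+\infty}x_{n}\overline{y_{n}}$. The Cesaro operator $\mathcal{C}$ is a bounded linear operator on $\ell^2$ (a known fact), and $\mathcal{C}^{\ast}$ denotes its Hilbert space adjoint. A bounded linear operator $T$ on a complex Hilbert space is called essentially normal if $T^{\ast}T-TT^{\ast}$ is a compact operator. A bounded linear operator $K:X\to Y$ between complex Banach spaces is called compact if it maps the closed unit ball of $X$ to a norm compact subset of $Y$ (for operators on a Hilbert space this is equivalent to the usual definition that the image of the closed unit ball is relatively compact). *)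

(* Defs.v *)
From HB Require Import structures.
From mathcomp Require Import all_boot all_order all_algebra.
From mathcomp Require Import complex.
From mathcomp Require Import all_classical all_reals all_analysis.
From mathcomp Require Import ring lra.

Set Implicit Arguments.
Unset Strict Implicit.
Unset Printing Implicit Defensive.

Import Order.TTheory GRing.Theory Num.Theory.
Import numFieldNormedType.Exports.
Import Normc.

Local Open Scope classical_set_scope.
Local Open Scope ring_scope.
Local Open Scope complex_scope.

Section SquareModulus.
Variable R : realType.
Implicit Types (z w : R[i]) (x y : nat -> R[i]).

(** [normc] is the modulus with values in [R]; [`|z|] has values in [R[i]]. *)
Definition sqnorm z : R := normc z ^+ 2.

Lemma sqnormE z : sqnorm z = complex.Re z ^+ 2 + complex.Im z ^+ 2.
Proof.
by case: z => a b; rewrite /sqnorm /= sqr_sqrtr// addr_ge0// sqr_ge0.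
Qed.

Lemma sqnorm_ge0 z : 0 <= sqnorm z. Proof. exact: sqr_ge0. Qed.

Lemma sqnormM z w : sqnorm (z * w) = sqnorm z * sqnorm w.
Proof. by rewrite /sqnorm normcM exprMn. Qed.

Lemma sqnorm_mulC z : z * z^*%R = (sqnorm z)%:C.
Proof.
by rewrite -normCK [`|z|]/Num.norm/= /sqnorm rmorphXn.
Qed.

Lemma sqnormD_le (t : R) z w : 0 < t ->
  sqnorm (z + w) <= (1 + t) * sqnorm z + (1 + t^-1) * sqnorm w.
Proof.
move=> t0; rewrite !sqnormE; case: z => a b; case: w => c d /=.
have h (u v : R) : (u + v) ^+ 2 <= (1 + t) * u ^+ 2 + (1 + t^-1) * v ^+ 2.
  rewrite -subr_ge0.
  have -> : (1 + t) * u ^+ 2 + (1 + t^-1) * v ^+ 2 - (u + v) ^+ 2 =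
     t * (u - t^-1 * v) ^+ 2 by field; rewrite gt_eqF.
  by rewrite mulr_ge0 ?sqr_ge0// ltW.
by rewrite !mulrDr; have := h a c; have := h b d; lra.
Qed.

(** A nonnegative real series converges iff its sum is finite, so this is
    the condition [\sum_n |x_n|^2 < +oo]. *)
Definition square_summable x : Prop := cvgn (series (fun n => sqnorm (x n))).

Lemma square_summable_bounded x (M : R) :
  (forall n, series (fun n => sqnorm (x n)) n <= M) -> square_summable x.
Proof.
move=> bM; apply: nondecreasing_is_cvgn; last by exists M => _ [n _ <-].
by apply: nondecreasing_series => n _ _; exact: sqnorm_ge0.
Qed.

Lemma series_sqnorm_le x n : square_summable x ->
  series (fun n => sqnorm (x n)) n <= limn (series (fun n => sqnorm (x n))).
Proof.
move=> sx; apply: nondecreasing_cvgn_le => //.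
by apply: nondecreasing_series => k _ _; exact: sqnorm_ge0.
Qed.

Lemma series_sqnormD_le (t : R) x y n : 0 < t ->
  square_summable x -> square_summable y ->
  series (fun n => sqnorm (x n + y n)) n <=
    (1 + t) * limn (series (fun n => sqnorm (x n))) +
    (1 + t^-1) * limn (series (fun n => sqnorm (y n))).
Proof.
move=> t0 sx sy.
apply: (@le_trans _ _ ((1 + t) * series (fun n => sqnorm (x n)) n +
    (1 + t^-1) * series (fun n => sqnorm (y n)) n)).
  rewrite /series/= !mulr_sumr -big_split/=; apply: ler_sum => i _.
  exact: sqnormD_le.
by apply: lerD; apply: ler_wpM2l; rewrite ?series_sqnorm_le// addr_ge0//
  ?invr_ge0 ltW.
Qed.

Lemma square_summable0 : square_summable (fun=> 0).
Proof.
apply: (@square_summable_bounded _ 0) => n; rewrite /series/= big1// => i _.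
by rewrite sqnormE/= expr0n addr0.
Qed.

Lemma square_summableD x y : square_summable x -> square_summable y ->
  square_summable (fun n => x n + y n).
Proof.
move=> sx sy; apply: square_summable_bounded => n.
exact: (@series_sqnormD_le 1).
Qed.

Lemma square_summableZ z x : square_summable x ->
  square_summable (fun n => z * x n).
Proof.
move=> sx.
apply: (@square_summable_bounded _
  (sqnorm z * limn (series (fun n => sqnorm (x n))))) => n.
rewrite /series/=; under eq_bigr do rewrite sqnormM.
by rewrite -mulr_sumr ler_wpM2l ?sqnorm_ge0//; exact: series_sqnorm_le.
Qed.

End SquareModulus.

Section ComplexLimits.
Variable R : realType.
Local Notation C := (R[i]^o).

Lemma cvg_real_complex (u : nat -> R) (l : R) :
  u @ \oo --> l -> (fun n => (u n)%:C : C) @ \oo --> (l%:C : C).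
Proof.
move=> /cvgrPdist_lt ul; apply/cvgrPdist_lt => e e0.
have [e' ee] : exists e', e = e'%:C.
  by apply/complex_realP; rewrite ger0_real// ltW.
move: e0; rewrite ee ltcR => e0; near=> n.
rewrite -rmorphB normc_def/= expr0n addr0 sqrtr_sqr ltcR.
by near: n; exact: ul.
Unshelve. all: by end_near. Qed.

Lemma cvgD_complex (u v : nat -> C) (a b : C) :
  u @ \oo --> a -> v @ \oo --> b -> (fun n => u n + v n) @ \oo --> a + b.
Proof. exact: cvgD. Qed.

Lemma cvgZ_complex (u : nat -> C) (a b : C) :
  u @ \oo --> a -> (fun n => b * u n : C) @ \oo --> (b * a : C).
Proof. exact: cvgMr. Qed.

Lemma cvg_complex (u : nat -> C) (a b : R) :
  (fun n => complex.Re (u n)) @ \oo --> a ->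
  (fun n => complex.Im (u n)) @ \oo --> b ->
  u @ \oo --> (a +i* b : C).
Proof.
move=> /cvg_real_complex ua /cvg_real_complex ub.
have := cvgD_complex ua (@cvgZ_complex _ _ 'i ub).
rewrite -(complexE (a +i* b)).
by under [X in X @ _]eq_fun do rewrite -complexE.
Qed.

Lemma Re_series (u : nat -> R[i]) n :
  complex.Re (series u n) = series (fun k => complex.Re (u k)) n.
Proof.
rewrite /series/=; elim: n => [|n IH]; first by rewrite !big_nil.
by rewrite !big_nat_recr//= -IH; case: (\sum_(_ <= _ < _) _); case: (u n).
Qed.

Lemma Im_series (u : nat -> R[i]) n :
  complex.Im (series u n) = series (fun k => complex.Im (u k)) n.
Proof.
rewrite /series/=; elim: n => [|n IH]; first by rewrite !big_nil.
by rewrite !big_nat_recr//= -IH; case: (\sum_(_ <= _ < _) _); case: (u n).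
Qed.

Lemma cvg_conj (u : nat -> C) (l : C) :
  u @ \oo --> l -> (fun n => (u n)^*%R : C) @ \oo --> (l^*%R : C).
Proof.
move=> /cvgrPdist_lt ul; apply/cvgrPdist_lt => e e0; near=> n.
by rewrite -rmorphB norm_conjC; near: n; exact: ul.
Unshelve. all: by end_near. Qed.

End ComplexLimits.

Section SequenceSpace.
Variable R : realType.

Definition l2_pred : {pred (nat -> R[i])} :=
  fun x => `[< square_summable x >].

Lemma l2_submod_closed : submod_closed l2_pred.
Proof.
split; first by apply/asboolP; exact: square_summable0.
move=> a x y /asboolP sx /asboolP sy; apply/asboolP.
exact: square_summableD (square_summableZ sx) sy.
Qed.

HB.instance Definition _ :=
  GRing.isSubmodClosed.Build R[i] (nat -> R[i]) l2_pred l2_submod_closed.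

Record l2 : Type := L2 { l2_seq :> nat -> R[i]; _ : l2_seq \in l2_pred }.

HB.instance Definition _ := [isSub for l2_seq].
HB.instance Definition _ := [Choice of l2 by <:].
HB.instance Definition _ := [SubChoice_isSubLmodule of l2 by <:].

Lemma l2P (x : l2) : square_summable x.
Proof. by case: x => x /= /asboolP. Qed.
Arguments l2P x : clear implicits.

Lemma l2D (x y : l2) n : (x + y) n = x n + y n. Proof. by []. Qed.
Lemma l2Z (a : R[i]) (x : l2) n : (a *: x) n = a * x n. Proof. by []. Qed.
Lemma l20 n : (0 : l2) n = 0. Proof. by []. Qed.
Lemma l2_ext (x y : l2) : x =1 y -> x = y.
Proof. by move=> xy; apply/val_inj/funext. Qed.

Definition mk_l2 (x : nat -> R[i]) (sx : square_summable x) : l2 :=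
  L2 (asboolT sx).

(** [R[i]^o] is [R[i]] seen as a normed space over itself. *)
Definition inner (x y : l2) : R[i] :=
  limn (series (fun n => x n * (y n)^*%R) : nat -> R[i]^o).

Lemma inner_cvg (x y : l2) :
  cvgn (series (fun n => x n * (y n)^*%R) : nat -> R[i]^o).
Proof.
have dom (f : R[i] -> R[i] -> R) :
    (forall z w, `|f z w| <= sqnorm z + sqnorm w) ->
    cvgn (series (fun n => f (x n) (y n))).
  move=> fle; apply: (@normed_cvg _ R^o).
  apply: (@series_le_cvg _ _ (fun n => sqnorm (x n) + sqnorm (y n))).
  - by move=> n /=.
  - by move=> n /=; rewrite addr_ge0// sqnorm_ge0.
  - by move=> n /=; exact: fle.
  - exact: is_cvg_seriesD (l2P x) (l2P y).
pose re (z w : R[i]) := complex.Re (z * w^*%R).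
pose im (z w : R[i]) := complex.Im (z * w^*%R).
have hre : cvgn (series (fun n => re (x n) (y n))).
  apply: dom => -[a b] [c d]; rewrite -[re _ _]/(a * c - b * - d) !sqnormE/= ler_norml.
  have := sqr_ge0 (a + c); have := sqr_ge0 (a - c).
  have := sqr_ge0 (b + d); have := sqr_ge0 (b - d).
  by have := sqr_ge0 a; have := sqr_ge0 b; have := sqr_ge0 c;
    have := sqr_ge0 d; move=> *; apply/andP; split; lra.
have him : cvgn (series (fun n => im (x n) (y n))).
  apply: dom => -[a b] [c d]; rewrite -[im _ _]/(a * - d + b * c) !sqnormE/= ler_norml.
  have := sqr_ge0 (a + d); have := sqr_ge0 (a - d).
  have := sqr_ge0 (b + c); have := sqr_ge0 (b - c).
  by have := sqr_ge0 a; have := sqr_ge0 b; have := sqr_ge0 c;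
    have := sqr_ge0 d; move=> *; apply/andP; split; lra.
suff h : (series (fun n => x n * (y n)^*%R) : nat -> R[i]^o) @ \oo -->
    (limn (series (fun n => re (x n) (y n))) +i*
     limn (series (fun n => im (x n) (y n))) : R[i]^o) by exact: (cvgP _ h).
apply: cvg_complex.
- by under [X in X @ _]eq_fun do rewrite Re_series.
- by under [X in X @ _]eq_fun do rewrite Im_series.
Qed.

Lemma inner_eq (x y : l2) (l : R[i]^o) :
  (series (fun n => x n * (y n)^*%R) : nat -> R[i]^o) @ \oo --> l ->
  inner x y = l.
Proof. exact: (cvg_lim (@norm_hausdorff _ R[i]^o)). Qed.

Lemma innerE (x : l2) :
  inner x x = (limn (series (fun n => sqnorm (x n))))%:C.
Proof.
apply: inner_eq; have /cvg_real_complex := l2P x.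
under [X in X @ _ --> _ -> _]eq_fun do rewrite /series/= rmorph_sum/=.
by under [X in X @ _ --> _ -> _]eq_fun do under eq_bigr do
  rewrite -sqnorm_mulC.
Qed.

Lemma innerPl (a : R[i]) (x x' y : l2) :
  inner (a *: x + x') y = a * inner x y + inner x' y.
Proof.
apply: inner_eq.
have := cvgD_complex (@cvgZ_complex _ _ _ a (@inner_cvg x y)) (@inner_cvg x' y).
under [X in X @ _ --> _ -> _]eq_fun do
  rewrite /series/= mulr_sumr -big_split/=.
by under [X in X @ _ --> _ -> _]eq_fun do under eq_bigr do
  rewrite mulrA -mulrDl.
Qed.

Lemma innerC (x y : l2) : inner x y = (inner y x)^*%R.
Proof.
apply: inner_eq; have := cvg_conj (@inner_cvg y x).
under [X in X @ _ --> _ -> _]eq_fun do rewrite /series/= rmorph_sum/=.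
by under [X in X @ _ --> _ -> _]eq_fun do under eq_bigr do
  rewrite rmorphM/= conjCK mulrC.
Qed.

Lemma inner_bilinear :
  bilinear_for ( *%R : R[i] -> R[i] -> R[i])
    (Num.conj \; *%R : R[i] -> R[i] -> R[i]) inner.
Proof.
split=> [y a x x'|x a y y']; first exact: innerPl.
by rewrite innerC innerPl rmorphD rmorphM/= -!innerC.
Qed.

HB.instance Definition _ := bilinear_isBilinear.Build R[i] l2 l2 R[i] *%R
  (Num.conj \; *%R) inner inner_bilinear.

Lemma inner_hermitian (x y : l2) :
  inner x y = (-1) ^+ false * (inner y x)^*%R.
Proof. by rewrite expr0 mul1r innerC. Qed.

HB.instance Definition _ := isHermitianSesquilinear.Build R[i] l2 false
  Num.conj inner inner_hermitian.

Lemma inner_gt0 (x : l2) : x != 0 -> 0 < inner x x.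
Proof.
move=> x0; rewrite innerE ltcR.
have [n xn0] : exists n, x n != 0.
  apply: contrapT => /forallNP x_eq0; move/eqP: x0; apply; apply: l2_ext => n.
  by apply/eqP; move: (x_eq0 n) => /negP; rewrite negbK.
apply: lt_le_trans (series_sqnorm_le n.+1 (l2P x)).
rewrite /series/= big_nat_recr//= ltr_wpDl//.
  by rewrite sumr_ge0// => i _; exact: sqnorm_ge0.
rewrite lt_neqAle sqnorm_ge0 andbT eq_sym sqrf_eq0.
by apply: contra xn0 => /eqP/eq0_normc ->.
Qed.

HB.instance Definition _ := isDotProduct.Build R[i] l2 inner inner_gt0.

(** Norms on modules over [R[i]] take values in [R[i]], whose order only
    compares numbers having the same imaginary part. *)
Definition l2_norm (x : l2) : R[i] := sqrtC (inner x x).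

Lemma l2_normE (x : l2) :
  l2_norm x = (Num.sqrt (limn (series (fun n => sqnorm (x n)))))%:C.
Proof.
have s0 : 0 <= limn (series (fun n => sqnorm (x n))).
  by have := series_sqnorm_le 0 (l2P x); rewrite /series/= big_nil.
apply/eqP; rewrite -(@eqrXn2 _ 2)//; last 2 first.
- by rewrite sqrtC_ge0 innerE ler0c.
- by rewrite ler0c sqrtr_ge0.
by rewrite sqrtCK innerE -rmorphXn/= sqr_sqrtr.
Qed.

Lemma l2_normD (x y : l2) : l2_norm (x + y) <= l2_norm x + l2_norm y.
Proof.
have [->|x0] := eqVneq x 0.
  by rewrite add0r lerDr sqrtC_ge0 dnorm_ge0.
have [->|y0] := eqVneq y 0.
  by rewrite addr0 lerDl sqrtC_ge0 dnorm_ge0.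
have := inner_gt0 x0; have := inner_gt0 y0.
rewrite !l2_normE !innerE !ltcR -rmorphD/= lecR.
set X : R := limn (series (fun n => sqnorm (x n))).
set Y : R := limn (series (fun n => sqnorm (y n))) => Y0 X0.
pose a : R := Num.sqrt X; pose b : R := Num.sqrt Y.
have a0 : 0 < a by rewrite sqrtr_gt0.
have b0 : 0 < b by rewrite sqrtr_gt0.
rewrite -/a -/b -(ger0_norm (addr_ge0 (ltW a0) (ltW b0))) -sqrtr_sqr.
rewrite ler_sqrt ?sqr_ge0//.
have -> : (a + b) ^+ 2 = (1 + b / a) * X + (1 + (b / a)^-1) * Y.
  rewrite -(sqr_sqrtr (ltW X0)) -(sqr_sqrtr (ltW Y0)) -/a -/b.
  by field; rewrite !gt_eqF.
apply: limr_le; first exact: (l2P (x + y)).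
apply: nearW => n; apply: series_sqnormD_le.
- by rewrite divr_gt0.
- exact: l2P.
- exact: l2P.
Qed.

Lemma l2_normZ (a : R[i]) (x : l2) : l2_norm (a *: x) = `|a| * l2_norm x.
Proof.
by rewrite /l2_norm dnormZ sqrtCM ?nnegrE ?exprn_ge0 ?dnorm_ge0// sqrCK.
Qed.

Lemma l2_norm0_eq0 (x : l2) : l2_norm x = 0 -> x = 0.
Proof. by move/eqP; rewrite sqrtC_eq0 dnorm_eq0 => /eqP. Qed.

HB.instance Definition _ := Lmodule_isNormed.Build R[i] l2
  l2_normD l2_normZ l2_norm0_eq0.

Lemma l2_normrE (x : l2) : `|x| = sqrtC (inner x x). Proof. by []. Qed.

End SequenceSpace.
Arguments l2P {R} x.

Section Cesaro.
Variable R : realType.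

Definition cesaro_seq (x : nat -> R[i]) : nat -> R[i] :=
  fun n => n.+1%:R^-1 * \sum_(0 <= k < n.+1) x k.

Let hardy_step_real (p u v : R) : 0 <= p -> (p = 0 -> u = 0) ->
  ((p + 1)^-1 * (u + v)) ^+ 2 / 2 + (u + v) ^+ 2 / (p + 1) <=
  u ^+ 2 / p + 2 * v ^+ 2.
Proof.
move=> p0 pu; have p10 : p + 1 != 0 by rewrite gt_eqF// ltr_wpDl.
pose w := (p + 1)^-1 * (u + v); rewrite -/w.
have uvE : u + v = (p + 1) * w by rewrite mulVKf.
have -> : (u + v) ^+ 2 / (p + 1) = (p + 1) * w ^+ 2.
  by rewrite uvE; field.
have [pe0|pn0] := eqVneq p 0.
  have u0 := pu pe0.
  move: uvE; rewrite pe0 u0 => uvE; rewrite expr0n/=.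
  have -> : w = v by move: uvE; lra.
  by have := sqr_ge0 v; lra.
have uE : u = p * w + (w - v) by move: uvE; lra.
have -> : u ^+ 2 / p = p * w ^+ 2 + 2 * w * (w - v) + (w - v) ^+ 2 / p.
  by rewrite uE; field.
have h1 : 0 <= (w - v) ^+ 2 / p by rewrite divr_ge0// sqr_ge0.
have h2 := sqr_ge0 (w - 2 * v).
by lra.
Qed.

Lemma sqnorm_natV_mul (n : nat) (z : R[i]) :
  sqnorm (n%:R^-1 * z) =
    (n%:R^-1 * complex.Re z) ^+ 2 + (n%:R^-1 * complex.Im z) ^+ 2.
Proof.
have -> : (n%:R^-1 : R[i]) = (n%:R^-1 : R)%:C by rewrite fmorphV rmorph_nat.
by rewrite sqnormE; case: z => a b /=; rewrite !mul0r subr0 addr0.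
Qed.

(** Hardy's inequality [\sum |C x|^2 <= 4 \sum |x|^2], for partial sums. *)
Lemma hardy (x : nat -> R[i]) (N : nat) :
  series (fun n => sqnorm (cesaro_seq x n)) N / 2 +
    sqnorm (\sum_(0 <= k < N) x k) / N%:R <=
  2 * series (fun n => sqnorm (x n)) N.
Proof.
elim: N => [|N IH]; first by rewrite /series/= !big_nil invr0 mulr0 !mul0r addr0.
have := IH; rewrite /series/= (big_nat_recr _ _ (fun n => sqnorm (cesaro_seq x n)))//=.
rewrite (big_nat_recr _ _ (fun n => sqnorm (x n)))//=.
rewrite {2}/cesaro_seq sqnorm_natV_mul (big_nat_recr _ _ x)//=.
have : N%:R = 0 :> R -> \sum_(0 <= k < N) x k = 0.
  by move/eqP; rewrite pnatr_eq0 => /eqP ->; rewrite big_nil.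
rewrite -(@natr1 R N); move: (\sum_(0 <= k < N) x k) => s s0.
rewrite !sqnormE; move: s0; case: s => a b; case: (x N) => c d /= s0.
have := @hardy_step_real N%:R a c (ler0n _ _) (fun e => congr1 (@complex.Re R) (s0 e)).
have := @hardy_step_real N%:R b d (ler0n _ _) (fun e => congr1 (@complex.Im R) (s0 e)).
rewrite ?mulrDl; lra.
Qed.

Lemma cesaro_square_summable (x : nat -> R[i]) :
  square_summable x -> square_summable (cesaro_seq x).
Proof.
move=> sx; apply: (@square_summable_bounded _ _
  (4 * limn (series (fun n => sqnorm (x n))))) => N.
have := hardy x N; have := series_sqnorm_le N sx.
have : 0 <= sqnorm (\sum_(0 <= k < N) x k) / N%:R.
  by rewrite divr_ge0// sqnorm_ge0.
lra.
Qed.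

Definition cesaro_op (x : l2 R) : l2 R := mk_l2 (cesaro_square_summable (l2P x)).

Lemma cesaro_opE (x : l2 R) n :
  cesaro_op x n = n.+1%:R^-1 * \sum_(0 <= k < n.+1) x k.
Proof. by []. Qed.

End Cesaro.

Section Operators.
Variable R : realType.

Definition bounded_operator (X Y : normedModType R[i]) (T : X -> Y) : Prop :=
  linear T /\ exists M : R[i], forall x, `|T x| <= M * `|x|.

(** The image of the closed unit ball is compact, not just its closure. *)
Definition compact_operator (X Y : normedModType R[i]) (K : X -> Y) : Prop :=
  bounded_operator K /\ compact (K @` [set x | `|x| <= 1]).

Definition is_adjoint (T S : l2 R -> l2 R) : Prop :=
  bounded_operator S /\ forall x y, inner (T x) y = inner x (S y).

Lemma is_adjoint_unique (T S S' : l2 R -> l2 R) :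
  is_adjoint T S -> is_adjoint T S' -> S = S'.
Proof.
move=> [_ TS] [_ TS']; apply/funext => y; apply/eqP.
rewrite -subr_eq0 -(dnorm_eq0 (@inner R)) linearBr/=.
by rewrite -TS -TS' subrr.
Qed.

(** [S] below is the Hilbert space adjoint of [T], which is unique by
    [is_adjoint_unique]. *)
Definition essentially_normal (T : l2 R -> l2 R) : Prop :=
  bounded_operator T /\
  exists S, is_adjoint T S /\ compact_operator (fun x => S (T x) - T (S x)).

End Operators.

(* Main.v *)
From HB Require Import structures.
Require Import Defs.
From mathcomp Require Import all_boot all_order all_algebra.
From mathcomp Require Import complex.
From mathcomp Require Import all_classical all_reals all_analysis.
From mathcomp Require Import ring lra.

(** The idea is the factorization [C^* C - C C^* = C^* L C], where [L] is the
    diagonal operator [(L x)_n = x_n / (n + 2)]; equivalently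
    [C C^* = C^* (1 - L) C].  Since [(C^* y)_n = \sum_(k >= n) y_k / (k + 1)], a
    vector [v] in [l^2] is of the form [C^* y] as soon as
    [v_n - v_(n+1) = y_n / (n + 1)] for all [n]: two square summable sequences
    with the same differences differ by a constant, which must be [0]
    ([l2_constant_eq0]).  For [v = C C^* x] an Abel summation gives
    [v_n - v_(n+1) = (C x)_n / (n + 2)] ([cesaro_adjoint_diff]), which is the
    difference of [C^* (1 - L) C x] because
    [(1 - 1/(n+2)) / (n + 1) = 1/(n+2)] ([commutator_factorization]).

    The operator [L C] is compact because the diagonal of [L] tends to [0]: on
    the unit ball, the tail of [L C x] is uniformly small, and its head depends
    on finitely many coordinates of [x].  To obtain that the image of the ball
    is itself compact, and not only its closure, the unit ball is identified
    with a closed subset of a product of segments, compact by Tychonoff's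
    theorem, and the operator is seen to be continuous from the topology of
    coordinatewise convergence on the ball to the norm topology
    ([compact_operator_coordinatewise]).

    The adjoint is built without Riesz representation, from its coordinates
    [(T^* y)_n = <y, T e_n>] ([adjoint_exists]). *)

Set Implicit Arguments.
Unset Strict Implicit.
Unset Printing Implicit Defensive.

Import Order.TTheory GRing.Theory Num.Theory.
Import numFieldNormedType.Exports.

Local Open Scope classical_set_scope.
Local Open Scope ring_scope.
Local Open Scope complex_scope.

(** * Squared norms, unit vectors and truncations *)

Section Energy.
Variable R : realType.
Implicit Types (x y : l2 R).

(** The squared norm, as an element of [R]: the norm of [l2 R] has values in
    [R[i]], whose order is only partial. *)
Definition energy x : R := limn (series (fun n => sqnorm (x n))).

Lemma inner_energy x : inner x x = (energy x)%:C.
Proof. exact: innerE. Qed.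

Lemma series_le_energy x n :
  series (fun n => sqnorm (x n)) n <= energy x.
Proof. exact: series_sqnorm_le (l2P x). Qed.

Lemma energy_le N x (M : R) :
  (forall n, (N <= n)%N -> series (fun n => sqnorm (x n)) n <= M) ->
  energy x <= M.
Proof. by move=> xM; apply: limr_le; [exact: l2P|exists N]. Qed.

Lemma energy_ge0 x : 0 <= energy x.
Proof. by have := series_le_energy x 0; rewrite /series/= big_nil. Qed.

Lemma l2_norm_energy x : `|x| = (Num.sqrt (energy x))%:C.
Proof. exact: l2_normE. Qed.

Lemma l2_norm_le x (c : R) : 0 <= c ->
  (`|x| <= c%:C) = (energy x <= c ^+ 2).
Proof.
move=> c0; rewrite l2_norm_energy lecR.
by rewrite -{1}(ger0_norm c0) -sqrtr_sqr ler_sqrt// sqr_ge0.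
Qed.

Lemma l2_norm_lt x (c : R) : 0 < c ->
  (`|x| < c%:C) = (energy x < c ^+ 2).
Proof.
move=> c0; rewrite l2_norm_energy ltcR -{1}(ger0_norm (ltW c0)) -sqrtr_sqr.
by rewrite ltr_sqrt// exprn_gt0.
Qed.

(** Expand [0 <= energy (energy y *: x - <x, y> *: y)]. *)
Lemma cauchy_schwarz x y : sqnorm (inner x y) <= energy x * energy y.
Proof.
have [->|y0] := eqVneq y 0.
  by rewrite linear0r sqnormE/= expr0n addr0 mulr_ge0 ?energy_ge0.
have Ey : 0 < energy y by have := inner_gt0 y0; rewrite inner_energy ltcR.
pose z := inner x y.
have := energy_ge0 ((energy y)%:C *: x - z *: y).
have -> : energy ((energy y)%:C *: x - z *: y) =
    energy y * (energy x * energy y - sqnorm z).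
  apply: complexI; rewrite -(inner_energy (_ - _)).
  have -> (u v : l2 R) : inner (u - v) (u - v) =
      inner u u - inner u v - (inner v u - inner v v).
    by rewrite linearBl/= !linearBr.
  have iZ b c (u v : l2 R) : inner (b *: u) (c *: v) = b * c^*%R * inner u v.
    by rewrite linearZl_LR/= linearZr_LR/= mulrA.
  rewrite !iZ !inner_energy (innerC y x) -/z rmorphM rmorphB rmorphM/=.
  rewrite -sqnorm_mulC.
  have -> : (energy y)%:C^*%R = (energy y)%:C :> R[i].
    by rewrite conj_Creal// complex_real.
  by ring.
by rewrite pmulr_rge0// subr_ge0.
Qed.

Lemma l2_sumE (I : Type) (r : seq I) (f : I -> l2 R) n :
  (\sum_(i <- r) f i) n = \sum_(i <- r) f i n.
Proof. by elim/big_ind2: _ => // x a y b; rewrite l2D => -> ->. Qed.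

Lemma unit_square_summable m :
  square_summable (fun n => (n == m)%:R : R[i]).
Proof.
apply: (@square_summable_bounded _ _ 1) => n; rewrite /series/=.
rewrite (eq_bigr (fun k => if k == m then 1 else 0)); last first.
  by move=> k _; case: eqP; rewrite sqnormE/= ?expr1n !expr0n addr0.
by rewrite -big_mkcond/= big_nat1_eq; case: ifP.
Qed.

Definition l2_unit m : l2 R := mk_l2 (@unit_square_summable m).

Lemma inner_unit x m : inner x (l2_unit m) = x m.
Proof.
apply: inner_eq; apply: cvg_near_cst.
near=> n; rewrite /series/= (eq_bigr (fun k => if k == m then x k else 0)).
  by rewrite -big_mkcond/= big_nat1_eq; rewrite ifT//=; near: n; exists m.+1.
by move=> k _; case: eqP; rewrite ?conjC1 ?conjC0 ?mulr1 ?mulr0.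
Unshelve. all: by end_near. Qed.

Definition truncate N (x : nat -> R[i]) : l2 R :=
  \sum_(0 <= k < N) x k *: l2_unit k.

Lemma truncateE N (x : nat -> R[i]) n :
  truncate N x n = if (n < N)%N then x n else 0.
Proof.
rewrite l2_sumE (eq_bigr (fun k => if k == n then x k else 0)); last first.
  by move=> k _; rewrite l2Z/= eq_sym; case: eqP; rewrite ?mulr1 ?mulr0.
by rewrite -big_mkcond/= big_nat1_eq.
Qed.

Lemma energy_truncate N (x : nat -> R[i]) :
  energy (truncate N x) <= series (fun n => sqnorm (x n)) N.
Proof.
apply: (@energy_le N) => m Nm; rewrite /series/= (big_cat_nat (leq0n N) Nm)//=.
rewrite [X in _ + X]big_nat_cond [X in _ + X]big1 ?addr0; last first.
  move=> k /andP[/andP[Nk _] _].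
  by rewrite truncateE ltnNge Nk sqnormE/= expr0n addr0.
by apply: ler_sum_nat => k /andP[_ kN]; rewrite truncateE kN.
Qed.

Lemma energy_tail N x :
  energy (x - truncate N x) <= energy x - series (fun n => sqnorm (x n)) N.
Proof.
have tailE k : (x - truncate N x) k = if (k < N)%N then 0 else x k.
  by rewrite l2D -[(- _ : l2 R) k]/(- truncate N x k) truncateE; case: ifP;
    rewrite ?subrr ?subr0.
move: (x - truncate N x) tailE => y tailE; apply: (@energy_le N) => m Nm.
apply: le_trans (lerB (series_le_energy x m) (lexx _)).
rewrite /series/= !(big_cat_nat (leq0n N) Nm)//= addrAC subrr add0r.
rewrite big_nat_cond big1 ?add0r; last first.
  move=> k /andP[/andP[_ kN] _].
  by rewrite tailE kN sqnormE/= expr0n addr0.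
apply: ler_sum_nat => k /andP[Nk _].
by rewrite tailE ltnNge Nk.
Qed.

Lemma cvg_energy_tail x :
  (fun N => energy (x - truncate N x)) @ \oo --> (0 : R).
Proof.
apply: (@squeeze_cvgr _ _ _ _ (fun=> 0)
  (fun N => energy x - series (fun n => sqnorm (x n)) N)).
- by near=> N; rewrite energy_ge0 energy_tail.
- exact: cvg_cst.
- rewrite -[X in _ --> X](subrr (energy x)).
  by apply: cvgB; [exact: cvg_cst|exact: l2P].
Unshelve. all: by end_near. Qed.

(** Reduces convergence in [R[i]], where the radii of balls are complex, to
    convergence in [R]. *)
Lemma complex_cvg_sqnorm (u : nat -> R[i]^o) (l : R[i]^o) (a : nat -> R) :
  (forall n, sqnorm (l - u n) <= a n) -> a @ \oo --> (0 : R) ->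
  u @ \oo --> l.
Proof.
move=> ua a0; apply/cvgrPdist_lt => e e0.
have [e' ee] : exists e', e = e'%:C.
  by apply/complex_realP; rewrite ger0_real// ltW.
move: e0; rewrite ee ltcR => e0.
have e20 : 0 < e' ^+ 2 by rewrite exprn_gt0.
have /cvgrPdist_lt/(_ _ e20) := a0.
apply: filterS => n; rewrite sub0r normrN => an.
rewrite [`|_|]/Num.norm/= ltcR -(@ltr_pXn2r _ 2)// ?nnegrE ?(ltW e0)//.
  by apply: le_lt_trans (ua n) _; apply: le_lt_trans an; exact: ler_norm.
by case: (l - u n) => ? ?; exact: sqrtr_ge0.
Qed.

(** * Adjoints of bounded operators *)

Section Adjoint.
Variables (T : {linear l2 R -> l2 R}) (M : R).
Hypothesis M0 : 0 <= M.
Hypothesis TM : forall x, energy (T x) <= M * energy x.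

Let adj_seq y : nat -> R[i] := fun n => inner y (T (l2_unit n)).

(** Evaluates [T] on finitely supported vectors through the candidate
    [adj_seq y] for the adjoint at [y]. *)
Lemma inner_truncate N (x : nat -> R[i]) y :
  inner (T (truncate N x)) y = \sum_(0 <= k < N) x k * (adj_seq y k)^*%R.
Proof.
rewrite /truncate; elim: N => [|N IH].
  by rewrite !big_nil linear0 linear0l.
rewrite !big_nat_recr//= linearD linearDl/= IH linearZ linearZl_LR/=.
by rewrite (innerC (T _)).
Qed.

(** Duality: testing [y] against [T v], where [v] is the truncation of
    [adj_seq y] itself, gives [s ^ 2 <= M s (energy y)] for the partial sum [s]. *)
Lemma adj_seq_bound y N :
  series (fun n => sqnorm (adj_seq y n)) N <= M * energy y.
Proof.
set s := series _ N; pose v := truncate N (adj_seq y).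
have Ev : energy v <= s by exact: energy_truncate.
have s0 : 0 <= s by apply: sumr_ge0 => k _; exact: sqnorm_ge0.
have := cauchy_schwarz (T v) y.
rewrite inner_truncate; under eq_bigr do rewrite sqnorm_mulC.
rewrite -rmorph_sum/= sqnormE/= expr0n addr0 -[X in X ^+ 2]/s => ss.
have {}ss : s * s <= s * (M * energy y).
  rewrite -expr2; apply: le_trans ss _; rewrite mulrA [s * M]mulrC.
  apply: ler_wpM2r; rewrite ?energy_ge0//; apply: le_trans (TM v) _.
  by rewrite ler_wpM2l.
have [->|sn0] := eqVneq s 0; first by rewrite mulr_ge0// energy_ge0.
by rewrite ler_pM2l// in ss; rewrite lt_neqAle eq_sym sn0.
Qed.

Lemma adj_square_summable y : square_summable (adj_seq y).
Proof. exact: square_summable_bounded (adj_seq_bound y). Qed.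

Definition adj y : l2 R := mk_l2 (@adj_square_summable y).

Lemma energy_adj y : energy (adj y) <= M * energy y.
Proof. by apply: (@energy_le 0) => n _; exact: adj_seq_bound. Qed.

Lemma adj_linear : linear adj.
Proof. by move=> a y z; apply: l2_ext => n; exact: innerPl. Qed.

(** Both sides agree on truncations of [x], and the error is controlled by the
    Cauchy-Schwarz inequality and the tail of [x]. *)
Lemma adjP x y : inner (T x) y = inner x (adj y).
Proof.
apply/esym/inner_eq.
apply: (@complex_cvg_sqnorm _ _
  (fun N => M * energy (x - truncate N x) * energy y)).
  move=> N; rewrite /series/= -inner_truncate -linearBl/= -linearB/=.
  apply: le_trans (cauchy_schwarz _ _) _.
  by rewrite ler_wpM2r ?energy_ge0.
rewrite -[X in _ --> X](mul0r (energy y)); apply: cvgMr_tmp.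
rewrite -[X in _ --> X](mulr0 M); apply: cvgMl_tmp.
exact: cvg_energy_tail.
Qed.

End Adjoint.

Lemma bounded_operator_energy (T : l2 R -> l2 R) (M : R) : 0 <= M -> linear T ->
  (forall x, energy (T x) <= M * energy x) -> bounded_operator T.
Proof.
move=> M0 Tlin TM; split=> //; exists (Num.sqrt M)%:C => x.
by rewrite !l2_norm_energy -rmorphM/= lecR -sqrtrM// ler_wsqrtr.
Qed.

(** The coordinates of the adjoint are part of the conclusion: the factorization
    of the self-commutator is proved from them. *)
Lemma adjoint_exists (T : {linear l2 R -> l2 R}) (M : R) : 0 <= M ->
  (forall x, energy (T x) <= M * energy x) ->
  exists S, [/\ is_adjoint T S, forall y, energy (S y) <= M * energy y &
    forall y n, S y n = inner y (T (l2_unit n))].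
Proof.
move=> M0 TM; exists (adj M0 TM); split=> //; last exact: energy_adj.
split; last by move=> x y; exact: adjP.
by apply: (bounded_operator_energy M0); [exact: adj_linear|exact: energy_adj].
Qed.

End Energy.

(** * Compactness from coordinatewise continuity *)

Section Compactness.
Variable R : realType.

Local Notation coords := {ptws (nat * bool) -> R}.

Lemma real_gt0c (a : R) : (0 < a%:C :> R[i]) = (0 < a).
Proof. by rewrite -(ltcR 0 a). Qed.

(** Real and imaginary parts of the terms serve as real coordinates, so that
    the factors of the product space are real segments. *)
Definition coords_seq (p : nat * bool -> R) : nat -> R[i] :=
  fun n => p (n, true) +i* p (n, false).

Definition coords_ball : set coords :=
  [set p | forall N, series (fun n => sqnorm (coords_seq p n)) N <= 1].

Lemma coord_continuous (i : nat * bool) :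
  continuous ((fun p => p i) : coords -> R).
Proof. exact: (@proj_continuous _ (fun=> R : topologicalType) i). Qed.

Lemma continuous_add_squares (T : topologicalType) (f g h : T -> R) :
  continuous f -> continuous g -> continuous h ->
  continuous (fun t => f t + (g t * g t + h t * h t)).
Proof.
by move=> fc gc hc t; apply: cvgD; [exact: fc|apply: cvgD; apply: cvgM];
  [exact: gc|exact: gc|exact: hc|exact: hc].
Qed.

Lemma series_coords_continuous N :
  continuous (fun p : coords => series (fun n => sqnorm (coords_seq p n)) N).
Proof.
elim: N => [|N IH].
  have -> : (fun p : coords => series (fun n => sqnorm (coords_seq p n)) 0) =
      fun=> 0 by apply/funext => p; rewrite /series/= big_nil.
  exact: (@cst_continuous coords R).
have -> : (fun p : coords => series (fun n => sqnorm (coords_seq p n)) N.+1) =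
    (fun p => series (fun n => sqnorm (coords_seq p n)) N +
      (p (N, true) * p (N, true) + p (N, false) * p (N, false))).
  by apply/funext => p; rewrite /series/= big_nat_recr//= sqnormE.
exact: continuous_add_squares IH (@coord_continuous _) (@coord_continuous _).
Qed.

Lemma coords_ball_compact : compact coords_ball.
Proof.
apply: (@subclosed_compact coords _
  [set p | forall i, `[(-1 : R), 1]%classic (p i)]).
- have -> : coords_ball = \bigcap_(N in setT)
      ((fun p => series (fun n => sqnorm (coords_seq p n)) N) @^-1`
        [set r | r <= 1]).
    by apply/seteqP; split=> [p pB N _|p pB N]; [exact: pB|exact: (pB N I)].
  apply: closed_bigI => N _; apply: preimage_closed; last exact: closed_le.
  by move=> p _; exact: series_coords_continuous.
- apply: (@tychonoff _ (fun=> R : topologicalType)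
    (fun=> `[(-1 : R), 1]%classic)).
  by move=> i; exact: segment_compact.
- move=> p pB [n b] /=.
  have : p (n, b) ^+ 2 <= 1.
    apply: le_trans (pB n.+1); rewrite /series/= big_nat_recr//= sqnormE/=.
    have : 0 <= \sum_(0 <= k < n) sqnorm (coords_seq p k).
      by apply: sumr_ge0 => k _; exact: sqnorm_ge0.
    have := sqr_ge0 (p (n, true)); have := sqr_ge0 (p (n, false)).
    by case: b; lra.
  by rewrite in_itv/= -ler_norml -(real_normK (num_real _)) expr_le1.
Qed.

(** By homogeneity, smallness of [K] at [0] for coordinatewise convergence in
    the unit ball means that [K] is continuous on the ball for that topology, in
    which the ball is compact. *)
Lemma compact_operator_coordinatewise (K : l2 R -> l2 R) :
  bounded_operator K ->
  (forall e : R, 0 < e -> exists N, exists2 d : R, 0 < d &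
    forall x : l2 R, energy x <= 1 ->
      (forall n, (n < N)%N -> sqnorm (x n) < d) ->
      energy (K x) < e) ->
  compact_operator K.
Proof.
move=> Kbd Kcoord; split=> //; have [Klin _] := Kbd.
pose F (p : coords) : l2 R := K (insubd 0 (coords_seq p)).
have coordsK p : coords_ball p ->
    insubd (0 : l2 R) (coords_seq p) = coords_seq p :> (nat -> R[i]).
  move=> pB; apply: insubdK; apply/asboolP;
  exact: square_summable_bounded pB.
have coords_energy p : coords_ball p -> energy (insubd 0 (coords_seq p)) <= 1.
  by move=> pB; apply: (@energy_le _ 0) => n _; rewrite coordsK.
have ballE (x : l2 R) : (`|x| <= 1) = (energy x <= 1).
  by rewrite (_ : 1 = 1%:C)// l2_norm_le// expr1n.
have -> : K @` [set x | `|x| <= 1] = F @` coords_ball.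
  apply/seteqP; split=> [_ [x /= x1 <-]|_ [p pB <-]]; last first.
    by exists (insubd 0 (coords_seq p)) => //=; rewrite ballE coords_energy.
  pose p (i : nat * bool) : R :=
    if i.2 then complex.Re (x i.1) else complex.Im (x i.1).
  have pE : coords_seq p = x :> (nat -> R[i]).
    by apply/funext => n; rewrite /coords_seq/p/=; case: (x n).
  exists p; last by rewrite /F pE valKd.
  move=> N; rewrite pE; apply: le_trans (series_le_energy _ _) _.
  by rewrite -ballE.
apply: continuous_compact coords_ball_compact.
apply/subspace_continuousP => p pB; apply/cvgrPdist_lt => e e0.
have [e' ee] : exists e', e = e'%:C.
  by apply/complex_realP; rewrite ger0_real// ltW.
move: e0; rewrite ee ltcR => e0.
have [|N [d d0 Kd]] := Kcoord ((e' / 2) ^+ 2).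
  by rewrite exprn_gt0// divr_gt0.
have nearp : \forall q \near nbhs p, forall i : 'I_N * bool,
    `|p (i.1 : nat, i.2) - q (i.1 : nat, i.2)| < Num.sqrt d.
  apply: filter_forall => i.
  have /cvgrPdist_lt := @coord_continuous (i.1 : nat, i.2) p; apply.
  by rewrite sqrtr_gt0.
near=> q.
have qB : coords_ball q by near: q; exact: withinT.
have qp : forall i : 'I_N * bool,
    `|p (i.1 : nat, i.2) - q (i.1 : nat, i.2)| < Num.sqrt d.
  by near: q; exact: cvg_within nearp.
(* The difference of two points of the unit ball has norm at most [2], hence the
   halving. *)
pose y := (2^-1 : R)%:C *:
  (insubd 0 (coords_seq p) - insubd 0 (coords_seq q) : l2 R).
have -> : F p - F q = (2 : R)%:C *: K y.
  have -> : F p = K ((2 : R)%:C *: y + insubd 0 (coords_seq q)).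
    by rewrite /y scalerA -rmorphM/= divff// scale1r subrK.
  by rewrite Klin addrK.
rewrite normrZ ger0_norm ?ler0c//.
have -> : e'%:C = 2%:C * (e' / 2)%:C :> R[i] by rewrite -rmorphM/= mulrC divfK.
rewrite ltr_pM2l ?real_gt0c// l2_norm_lt ?divr_gt0//; apply: Kd.
  rewrite -ballE normrZ ger0_norm ?ler0c ?invr_ge0//.
  have -> : 1 = (2^-1)%:C * (1 + 1) :> R[i].
    by rewrite -(rmorph1 (real_complex R)) -rmorphD -rmorphM/= mulVf.
  rewrite ler_pM2l ?real_gt0c ?invr_gt0//; apply: le_trans (ler_normB _ _) _.
  by apply: lerD; rewrite ballE coords_energy.
move=> n nN; have -> : y n = (2^-1)%:C * (coords_seq p n - coords_seq q n).
  by rewrite -(coordsK p pB) -(coordsK q qB).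
have near_sq b : (p (n, b) - q (n, b)) ^+ 2 < d.
  rewrite -(sqr_sqrtr (ltW d0)) -(real_normK (num_real (_ - _))).
  rewrite ltr_pXn2r// ?nnegrE ?sqrtr_ge0//.
  exact: (qp (Ordinal nN, b)).
rewrite sqnormM !sqnormE/= expr0n addr0.
by have := near_sq true; have := near_sq false; lra.
Unshelve. all: by end_near. Qed.

End Compactness.

(** * The Cesaro operator and the diagonal damping *)

Section Cesaro.
Variable R : realType.
Implicit Types (x y z : l2 R).

Lemma cesaro_linear : linear (@cesaro_op R).
Proof.
move=> a x y; apply: l2_ext => n; rewrite l2D l2Z !cesaro_opE.
under eq_bigr do rewrite l2D l2Z.
by rewrite big_split/= -mulr_sumr mulrDr mulrCA.
Qed.

HB.instance Definition _ :=
  GRing.isLinear.Build R[i] (l2 R) (l2 R) *:%R (@cesaro_op R) cesaro_linear.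

Lemma series_cesaro_le x N :
  series (fun n => sqnorm (cesaro_op x n)) N <=
  4 * series (fun n => sqnorm (x n)) N.
Proof.
have := hardy x N.
have : 0 <= sqnorm (\sum_(0 <= k < N) x k) / N%:R.
  by rewrite divr_ge0// sqnorm_ge0.
rewrite -[cesaro_op x : nat -> _]/(cesaro_seq x); lra.
Qed.

Lemma energy_cesaro x : energy (cesaro_op x) <= 4 * energy x.
Proof.
apply: (@energy_le _ 0) => n _; apply: le_trans (series_cesaro_le x n) _.
by rewrite ler_pM2l// series_le_energy.
Qed.

Lemma sqnorm_damp n (w : R[i]) :
  sqnorm (n.+2%:R^-1 * w) = (n.+2%:R ^- 2) * sqnorm w.
Proof. by rewrite sqnorm_natV_mul sqnormE !exprMn -mulrDr exprVn. Qed.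

Lemma sqnorm_damp_le n (w : R[i]) : sqnorm (n.+2%:R^-1 * w) <= sqnorm w.
Proof.
rewrite sqnorm_damp ler_piMl ?sqnorm_ge0// invf_le1 ?exprn_gt0 ?ltr0n//.
by rewrite exprn_ege1// ler1n.
Qed.

Lemma damp_square_summable x :
  square_summable (fun n => n.+2%:R^-1 * x n).
Proof.
apply: (@square_summable_bounded _ _ (energy x)) => N.
apply: le_trans (series_le_energy x N); apply: ler_sum => n _.
exact: sqnorm_damp_le.
Qed.

(** The diagonal operator [L] of the factorization. *)
Definition damp x : l2 R := mk_l2 (@damp_square_summable x).

Lemma damp_linear : linear damp.
Proof.
move=> a x y; apply: l2_ext => n /=.
by rewrite -[RHS]/(a * (n.+2%:R^-1 * x n) + n.+2%:R^-1 * y n) mulrDr mulrCA.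
Qed.

(** The weights are at most [1] on the first [N] terms and at most [1 / (N + 2)]
    on the others. *)
Lemma energy_damp_head x N :
  energy (damp x) <= series (fun n => sqnorm (x n)) N + N.+2%:R ^- 2 * energy x.
Proof.
apply: (@energy_le _ N) => m Nm; rewrite /series/= (big_cat_nat (leq0n N) Nm)/=.
apply: lerD.
  apply: ler_sum => n _.
  exact: sqnorm_damp_le.
apply: le_trans (_ : N.+2%:R ^- 2 * series (fun n => sqnorm (x n)) m <= _).
  rewrite /series/= mulr_sumr (big_cat_nat (leq0n N) Nm)/=; apply: ler_wpDl.
    apply: sumr_ge0 => n _.
    by rewrite mulr_ge0 ?sqnorm_ge0// invr_ge0 exprn_ge0.
  apply: ler_sum_nat => n /andP[Nn _]; rewrite sqnorm_damp.
  rewrite ler_wpM2r ?sqnorm_ge0// lef_pV2 ?posrE ?exprn_gt0 ?ltr0n//.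
  by rewrite ler_pXn2r ?nnegrE// ler_nat.
by rewrite ler_wpM2l ?invr_ge0 ?exprn_ge0 ?series_le_energy.
Qed.

Lemma energy_damp x : energy (damp x) <= energy x.
Proof.
apply: (@energy_le _ 0) => n _; apply: le_trans (series_le_energy x n).
by apply: ler_sum => k _; exact: sqnorm_damp_le.
Qed.

(** A constant sequence whose squares are summable has terms tending to [0]. *)
Lemma l2_constant_eq0 z : (forall n, z n = z n.+1) -> z = 0.
Proof.
move=> zS.
have zE n : z n = z 0 by elim: n => // n; rewrite zS.
have z0 : sqnorm (z 0) = 0.
  have := cvg_series_cvg_0 (l2P z).
  have -> : (fun n => sqnorm (z n)) = fun=> sqnorm (z 0).
    by apply/funext => n; rewrite zE.
  by move=> /(cvg_lim (@Rhausdorff R)); rewrite lim_cst//; exact: Rhausdorff.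
apply: l2_ext => n; rewrite zE l20; apply/eqP.
by apply/eqP/Normc.eq0_normc/eqP; rewrite -sqrf_eq0 -[_ ^+ 2]/(sqnorm _) z0.
Qed.

(** * The factorization of the self-commutator *)

Section AdjointFormula.
Variable S : l2 R -> l2 R.
Hypothesis SE : forall y n, S y n = inner y (cesaro_op (l2_unit R n)).

(** [C e_n - C e_(n+1) = e_n / (n + 1)], because [C e_n] vanishes before the
    index [n] and has terms [1 / (k + 1)] from there on. *)
Lemma adjoint_diff y n : S y n - S y n.+1 = n.+1%:R^-1 * y n.
Proof.
rewrite !SE -linearBr/=.
have sum_unit m p : \sum_(0 <= k < m) l2_unit R p k = (p < m)%:R.
  rewrite (eq_bigr (fun k => if k == p then 1 else 0)); last first.
    by move=> k _ /=; case: eqP.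
  by rewrite -big_mkcond/= big_nat1_eq/=; case: ifP.
have -> : cesaro_op (l2_unit R n) - cesaro_op (l2_unit R n.+1) =
    n.+1%:R^-1 *: l2_unit R n.
  apply: l2_ext => k.
  rewrite -[LHS]/(cesaro_op (l2_unit R n) k - cesaro_op (l2_unit R n.+1) k).
  rewrite !cesaro_opE !sum_unit !ltnS -mulrBr l2Z/=.
  by case: (ltngtP n k) => [nk|nk|->]; rewrite ?subrr ?subr0 ?mulr0.
by rewrite linearZr_LR/= inner_unit conj_Creal// rpredV realn.
Qed.

(** With [u = S x], one has
    [(C u)_n - (C u)_(n+1) = ((C u)_n - u_(n+1)) / (n + 2)], and the Abel
    summation
    [\sum_(k <= n) (u_k - u_(n+1)) = \sum_(k <= n) (k + 1) (u_k - u_(k+1))] with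
    [adjoint_diff] identifies [(C u)_n - u_(n+1)] with [(C x)_n]. *)
Lemma cesaro_adjoint_diff x n :
  cesaro_op (S x) n - cesaro_op (S x) n.+1 = n.+2%:R^-1 * cesaro_op x n.
Proof.
have abel m : \sum_(0 <= k < m.+1) S x k - m.+1%:R * S x m.+1 =
    \sum_(0 <= k < m.+1) x k.
  have dS k : S x k = S x k.+1 + k.+1%:R^-1 * x k.
    by rewrite -adjoint_diff addrC subrK.
  elim: m => [|m IH].
    by rewrite !big_nat1 dS invr1 !mul1r addrAC subrr add0r.
  rewrite [LHS](_ : _ = \sum_(0 <= k < m.+1) S x k - m.+1%:R * S x m.+1 +
     m.+2%:R * (S x m.+1 - S x m.+2)); last first.
    by rewrite big_nat_recr//= -[m.+2%:R]natr1; ring.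
  rewrite IH adjoint_diff mulVKf ?pnatr_eq0//.
  by rewrite [RHS]big_nat_recr.
rewrite !cesaro_opE -abel [\sum_(0 <= k < n.+2) _]big_nat_recr//=.
move: (\sum_(_ <= _ < _) _) (S x n.+1) => U u.
have : n.+1%:R != 0 :> R[i] by rewrite pnatr_eq0.
have : n.+2%:R != 0 :> R[i] by rewrite pnatr_eq0.
rewrite -[n.+2%:R]natr1; move: (n.+1%:R) => c; move=> *; field.
by apply/andP.
Qed.

(** Both sides have the same successive differences, by [adjoint_diff] and
    [cesaro_adjoint_diff]. *)
Lemma commutator_factorization x :
  S (cesaro_op x) - cesaro_op (S x) = S (damp (cesaro_op x)).
Proof.
apply/eqP; rewrite -subr_eq0; apply/eqP; apply: l2_constant_eq0 => n.
have SC := adjoint_diff (cesaro_op x) n.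
have SD := adjoint_diff (damp (cesaro_op x)) n.
have CS := cesaro_adjoint_diff x n.
rewrite -[LHS]/(S (cesaro_op x) n - cesaro_op (S x) n -
  S (damp (cesaro_op x)) n).
rewrite -[RHS]/(S (cesaro_op x) n.+1 - cesaro_op (S x) n.+1 -
  S (damp (cesaro_op x)) n.+1).
rewrite -[X in X - _ - _](subrK (S (cesaro_op x) n.+1)) SC.
rewrite -[X in _ - X - _](subrK (cesaro_op (S x) n.+1)) CS.
rewrite -[X in _ - _ - X = _](subrK (S (damp (cesaro_op x)) n.+1)) SD.
rewrite -[damp (cesaro_op x) n]/(n.+2%:R^-1 * cesaro_op x n).
have : n.+1%:R != 0 :> R[i] by rewrite pnatr_eq0.
have : n.+2%:R != 0 :> R[i] by rewrite pnatr_eq0.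
rewrite -[n.+2%:R]natr1; move: (n.+1%:R) => c c1 c0; field.
by apply/andP.
Qed.

End AdjointFormula.

End Cesaro.

(** * Essential normality *)

Theorem mainTheorem1 (R : realType) : essentially_normal (@cesaro_op R).
Proof.
have C4 := @energy_cesaro R; have four : 0 <= 4 :> R by [].
split; first exact: (bounded_operator_energy four (@cesaro_linear R) C4).
have [S [adjS S4 SE]] := adjoint_exists four C4.
exists S; split=> //; have [[Slin _] _] := adjS.
have -> : (fun x => S (cesaro_op x) - cesaro_op (S x)) =
    (fun x => S (damp (cesaro_op x))).
  by apply/funext => x; exact: commutator_factorization.
have KE x : energy (S (damp (cesaro_op x))) <= 4 * energy (damp (cesaro_op x)).
  exact: S4.
apply: compact_operator_coordinatewise.
  apply: (@bounded_operator_energy _ _ 16) => //.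
    by move=> a x y; rewrite cesaro_linear damp_linear Slin.
  move=> x; have := KE x; have := energy_damp (cesaro_op x); have := C4 x; lra.
move=> e e0.
have [N Ne] : exists N : nat, 32 / e < N%:R.
  by exists (Num.bound (32 / e)); apply: archi_boundP; rewrite divr_ge0// ltW.
have N1 : 0 < N.+1%:R :> R by rewrite ltr0n.
(* With [d] the second witness, the first [N] terms of [C x] contribute at most
   [16 N d <= e / 2] and the others at most [16 / (N + 2) ^ 2 < e / 2]: of the
   factor [16], [4] comes from [S] and [4] from Hardy's inequality for [C]. *)
exists N, (e / (32 * N.+1%:R)); first by rewrite divr_gt0// mulr_gt0.
move=> x x1 xd.
have head : series (fun n => sqnorm (x n)) N <= N%:R * (e / (32 * N.+1%:R)).
  rewrite /series/= mulr_natl -[X in _ *+ X]subn0 -sumr_const_nat.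
  by apply: ler_sum_nat => n /andP[_ nN]; exact: ltW (xd n nN).
have headE : 16 * (N%:R * (e / (32 * N.+1%:R))) <= e / 2.
  rewrite (_ : 16 * _ = e / 2 * (N%:R / N.+1%:R)).
    apply: ler_piMr; first by rewrite divr_ge0// ltW.
    by rewrite ler_pdivrMr// mul1r ler_nat.
  by field; rewrite gt_eqF.
have tail : 16 * N.+2%:R ^- 2 < e / 2.
  have N2 : 32 < e * N.+2%:R ^+ 2.
    apply: lt_le_trans (_ : e * N%:R <= _); first by rewrite mulrC -ltr_pdivrMr.
    rewrite ler_pM2l// -natrX ler_nat -mulnn.
    by rewrite (leq_trans _ (leq_pmulr _ _))// leqW.
  by rewrite ltr_pdivrMr ?exprn_gt0 ?ltr0n//; lra.
have := KE x; have := energy_damp_head (cesaro_op x) N.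
have := series_cesaro_le x N.
have : N.+2%:R ^- 2 * energy (cesaro_op x) <= N.+2%:R ^- 2 * 4.
  rewrite ler_wpM2l ?invr_ge0 ?exprn_ge0//; apply: le_trans (C4 x) _.
  by rewrite ler_piMr.
move: tail; move: (N.+2%:R ^- 2) head headE => w.
move: (w * energy _) (N%:R * _) => a b; move: (series _ N) (series _ N) => s t.
lra.
Qed.
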